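(* Let $A=\{a_1,\ldots,a_k\}$ be a set of $k$ distinct positive integers with $a_1<a_2<\cdots<a_k$. If a tree $T$ has order at most $$\left(\sum_{i=1}^k a_i\right)+a_k-1+\left\lfloor\frac{k^2-3k+2}{6}\right\rfloor,$$ then $T$ is $A$-burnable.
   Context: For a vertex $u$ of a graph and an integer $m\ge 0$, $N_m[u]$ denotes the set of vertices at distance at most $m$ from $u$. For a set $A$ of positive integers $a_1,\ldots,a_k$, a graph $G$ is called $A$-burnable if there exist $k$ vertices $v_1,\ldots,v_k$ of $G$ (not necessarily distinct) such that $V(G)\subseteq\bigcup_{i=1}^k N_{a_i-1}[v_i]$. The order of a graph is its number of vertices. *)

(* Defs.v *)
From mathcomp Require Import all_boot.
Set Implicit Arguments. Unset Strict Implicit. Unset Printing Implicit Defensive.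

Definition simple_graph (T : finType) (e : rel T) : Prop :=
  symmetric e /\ irreflexive e.

Definition has_cycle (T : finType) (e : rel T) : Prop :=
  exists (x : T) (p : seq T),
    [/\ 2 <= size p, uniq (x :: p), path e x p & e (last x p) x].

Definition is_tree (T : finType) (e : rel T) : Prop :=
  [/\ simple_graph e, 0 < #|T|, (forall x y : T, connect e x y) & ~ has_cycle e].

Definition within_dist (T : finType) (e : rel T) (u v : T) (m : nat) : Prop :=
  exists p : seq T, [/\ path e u p, last u p = v & size p <= m].

Definition burnable (T : finType) (e : rel T) (a : seq nat) : Prop :=
  exists v : 'I_(size a) -> T,
    forall x : T, exists i : 'I_(size a), within_dist e (v i) x (nth 0 a i).-1.

(* Main.v *)
(* Root the tree at [r] and burn it from the bottom: only a breadth-first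
   spanning tree is used. Let [M] be the largest radius, [s] the others,
   [g = size s %/ 3], and let [x] be a deepest remaining vertex. If [x] has
   depth less than [M], a ball of radius [M - 1] at [r] covers everything.
   Otherwise let [B] be the largest element of [s] and [w] the ancestor [B - 1]
   levels above [x]. The subtree at [w] fits in a ball of radius [B - 1] at [w];
   if it has at least [B + g] vertices, remove it. If not, fewer than [g] of its
   vertices lie off the path to [x]; then, for the element [b] of [s] standing
   [g] places before [B], the subtree [b + g - 1] levels above [x] fits in the
   ball of radius [b - 1] centred [b - 1] levels above [x], because
   [2 * g <= b]. Either way one radius [m] removes at least [m + g] vertices,
   and these gains [g] add up to the quadratic term. With [M] alone left, at
   most [2 * M - 1] vertices remain; the subtree [M - 1] levels above [x]
   accounts for [M] of them, so the connected rest is also close to its top. *)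

Require Import Defs.
From mathcomp Require Import all_boot.
From mathcomp Require Import zify.
Set Implicit Arguments. Unset Strict Implicit. Unset Printing Implicit Defensive.

Lemma within_dist_trans (T : finType) (e : rel T) x y z m n :
  within_dist e x y m -> within_dist e y z n -> within_dist e x z (m + n).
Proof.
move=> [p [pp lp sp]] [q [pq lq sq]]; exists (p ++ q).
by rewrite cat_path last_cat size_cat pp lp pq lq leq_add.
Qed.

Lemma within_dist_leq (T : finType) (e : rel T) x y m n :
  m <= n -> within_dist e x y m -> within_dist e x y n.
Proof. by move=> mn [p [pp lp sp]]; exists p; split=> //; apply: leq_trans mn. Qed.

Lemma within_dist_refl (T : finType) (e : rel T) x m : within_dist e x x m.
Proof. by exists [::]. Qed.

Lemma within_dist_sym (T : finType) (e : rel T) x y m :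
  symmetric e -> within_dist e x y m -> within_dist e y x m.
Proof.
move=> es [p [pp lp sp]]; exists (rev (belast x p)); split.
- by rewrite -lp rev_path (eq_path (e' := e)) // => u v; rewrite es.
- by case: p pp lp sp => //= z p _ _ _; rewrite rev_cons last_rcons.
- by rewrite size_rev size_belast.
Qed.

Lemma mulnS_divn6_leq n : (n.+1 * n) %/ 6 <= n.+1 %/ 3 + (n * n.-1) %/ 6.
Proof.
have Eq := divn_eq n 3; have lt3 := ltn_pmod n (isT : 0 < 3).
set q := n %/ 3 in Eq; set t := n %% 3 in Eq lt3.
have [m Em] : exists m, q * q = q + m.*2.
  exists (q * q.-1)./2; rewrite even_halfK; first by nia.
  by case: (q) => // k; rewrite oddM /=; case: odd.
have [t0|t1|t2] : [\/ t = 0, t = 1 | t = 2].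
- by case: t lt3 {Eq} => [|[|[|//]]] _; [constructor 1|constructor 2|constructor 3].
- have -> : n.+1 * n = (3 * m + 2 * q) * 6 by nia.
  have -> : n * n.-1 = (3 * m + q) * 6 by nia.
  by rewrite !mulnK //; lia.
- have -> : n.+1 * n = (3 * m + 3 * q) * 6 + 2 by nia.
  have -> : n * n.-1 = (3 * m + 2 * q) * 6 by nia.
  by rewrite divnMDl // mulnK //; lia.
- have -> : n.+1 * n = (3 * m + 4 * q + 1) * 6 by nia.
  have -> : n * n.-1 = (3 * m + 3 * q) * 6 + 2 by nia.
  by rewrite divnMDl // mulnK //; lia.
Qed.

Lemma sorted_ltn_nth_ge s i j : sorted ltn s -> i + j < size s ->
  nth 0 s i + j <= nth 0 s (i + j).
Proof.
move=> s_srt; elim: j => [|j IH] lt_j; first by rewrite !addn0.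
have : nth 0 s (i + j) < nth 0 s (i + j).+1.
  by apply: (sorted_ltn_nth ltn_trans); rewrite // ?inE; lia.
by rewrite !addnS; have := IH ltac:(lia); lia.
Qed.

(* With [g = size s %/ 3], [B] is the largest element of [s] and [b] the one
   [g] places before it: at least [size s - g >= 2 * g] elements are [<= b]. *)
Lemma sorted_gap s M : sorted ltn (rcons s M) -> all (leq 1) s -> 0 < size s ->
  exists b B, [/\ b \in s, B \in s &
    [/\ 0 < b, b + size s %/ 3 <= B, B < M & (size s %/ 3).*2 <= b]].
Proof.
move=> sM_srt s_pos; move En: (size s) => n n_gt0.
have := leq_trunc_div n 3; move: (n %/ 3) => g g_n.
have s_srt : sorted ltn s.
  by apply: (subseq_sorted ltn_trans (subseq_rcons s M)).
have b_s : nth 0 s (n.-1 - g) \in s by rewrite mem_nth // En; lia.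
exists (nth 0 s (n.-1 - g)), (nth 0 s n.-1); split=> //.
  by rewrite mem_nth // En; lia.
split; first exact: (allP s_pos).
- have := @sorted_ltn_nth_ge s (n.-1 - g) g s_srt.
  by rewrite subnK ?En; [apply|]; lia.
- have := @sorted_ltn_nth_ge (rcons s M) n.-1 1 sM_srt.
  rewrite size_rcons addn1 prednK // !nth_rcons En ltnn eqxx ltn_predL n_gt0.
  by rewrite addn1; apply.
- have := @sorted_ltn_nth_ge s 0 (n.-1 - g) s_srt.
  have s0 : 0 < nth 0 s 0 by apply: (allP s_pos); rewrite mem_nth // En.
  by rewrite add0n En => /(_ ltac:(lia)); lia.
Qed.

Section RootedGraph.

Variables (T : finType) (e : rel T) (r : T) (par : T -> T) (dep : T -> nat).
Implicit Types (S : {set T}) (x y : T).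
Hypothesis e_sym : symmetric e.
Hypothesis par_edge : forall x, 0 < dep x -> e x (par x).
Hypothesis dep_par : forall x, dep (par x) = (dep x).-1.
Hypothesis dep_eq0 : forall x, dep x = 0 -> x = r.

(* When [dep c > dep y] the truncated subtraction makes this [y == c], which
   is then false; so [anc c y] entails [dep c <= dep y]. *)
Definition anc c y := iter (dep y - dep c) par y == c.

Definition desc (S : {set T}) c := [set y in S | anc c y].

Definition par_closed (S : {set T}) := forall y, y \in S -> par y \in S.

Lemma dep_iter n y : dep (iter n par y) = dep y - n.
Proof. by elim: n => [|n IH] /=; rewrite ?subn0 // dep_par IH; lia. Qed.

Lemma ancP c y : reflect (exists2 n, n <= dep y & c = iter n par y) (anc c y).
Proof.
apply: (iffP eqP) => [<-|[n le_n ->]]; first by exists (dep y - dep c); rewrite ?leq_subr.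
by rewrite dep_iter; congr iter; lia.
Qed.

Lemma anc_iter n y : n <= dep y -> anc (iter n par y) y.
Proof. by move=> le_n; apply/ancP; exists n. Qed.

Lemma anc_refl y : anc y y.
Proof. exact: (@anc_iter 0). Qed.

Lemma anc_dep c y : anc c y -> dep c <= dep y.
Proof. by case/ancP=> n _ ->; rewrite dep_iter leq_subr. Qed.

Lemma anc_trans b a c : anc a b -> anc b c -> anc a c.
Proof.
case/ancP=> n le_n -> /ancP[m le_m Eb]; rewrite Eb -iterD anc_iter //.
by move: le_n; rewrite Eb dep_iter; lia.
Qed.

Lemma anc_total x a b : anc a x -> anc b x -> dep a <= dep b -> anc a b.
Proof.
case/ancP=> n le_n -> /ancP[m le_m ->]; rewrite !dep_iter => le_ab.
have -> : n = (n - m) + m by lia.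
by rewrite iterD anc_iter // dep_iter; lia.
Qed.

Lemma anc_par y : anc (par y) y.
Proof.
case: (posnP (dep y)) => [dy0|dy_gt0]; last exact: (@anc_iter 1).
have dp0 : dep (par y) = 0 by rewrite dep_par dy0.
rewrite (dep_eq0 dp0) (dep_eq0 dy0).
exact: anc_refl.
Qed.

Lemma within_dist_iter n y : n <= dep y -> within_dist e y (iter n par y) n.
Proof.
elim: n => [|n IH] le_n; first exact: within_dist_refl.
rewrite -[m in within_dist _ _ _ m]addn1.
apply: within_dist_trans (IH (ltnW le_n)) _.
exists [:: iter n.+1 par y]; split=> //=.
by rewrite par_edge // dep_iter subn_gt0.
Qed.

Lemma within_dist_anc c y m :
  anc c y -> dep y - dep c <= m -> within_dist e c y m.
Proof.
case/ancP=> n le_n ->; rewrite dep_iter => le_m; apply: within_dist_sym => //.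
by apply: within_dist_leq (within_dist_iter le_n); lia.
Qed.

Lemma anc_root y : anc r y.
Proof. by apply/ancP; exists (dep y); rewrite // [RHS](@dep_eq0) // dep_iter subnn. Qed.

Lemma dep_root0 : dep r = 0.
Proof.
have d0 : dep (iter (dep r) par r) = 0 by rewrite dep_iter subnn.
by rewrite -{1}(dep_eq0 d0).
Qed.

Lemma par_closed_iter S n y : par_closed S -> y \in S -> iter n par y \in S.
Proof. by move=> S_cl yS; elim: n => //= n; apply: S_cl. Qed.

Lemma par_closedD S c : par_closed S -> par_closed (S :\: desc S c).
Proof.
move=> S_cl y; rewrite !inE => /andP[]; case: (boolP (y \in S)) => //= yS ncy _.
rewrite S_cl // andbT; apply: contra ncy => /= cy.
exact: anc_trans cy (anc_par y).
Qed.

Lemma root_in_setD S c : r \in S -> 0 < dep c -> r \in S :\: desc S c.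
Proof.
move=> rS dc; rewrite !inE rS andbT /=; apply/negP => /anc_dep.
by rewrite dep_root0 leqNgt dc.
Qed.

Lemma card_desc_setD S c : #|desc S c| + #|S :\: desc S c| = #|S|.
Proof.
rewrite -(cardsID (desc S c) S); congr (#|pred_of_set _| + _).
by apply/esym/setIidPr/subsetP=> y; rewrite inE => /andP[].
Qed.

Lemma card_iter_le (A : {set T}) n y : n <= (dep y).+1 ->
  (forall i, i < n -> iter i par y \in A) -> n <= #|A|.
Proof.
move=> le_n inA; pose f (i : 'I_n) := iter i par y.
have f_inj : injective f.
  move=> i j /(congr1 dep); rewrite !dep_iter => Eij; apply: val_inj => /=.
  by have := ltn_ord i; have := ltn_ord j; lia.
rewrite -[n in n <= _]card_ord -(card_imset predT f_inj).
by apply/subset_leq_card/subsetP=> _ /imsetP[i _ ->]; apply: inA.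
Qed.

Lemma anc_at_height S x n : par_closed S -> x \in S -> n <= dep x ->
  exists w, [/\ anc w x, dep w = dep x - n &
    n < #|desc S w :&: [set y | anc y x]|].
Proof.
move=> S_cl xS le_n; exists (iter n par x); split; rewrite ?dep_iter ?anc_iter //.
apply: (@card_iter_le _ n.+1 x) => // i lt_i.
rewrite !inE par_closed_iter // anc_iter ?andbT /=; last by lia.
by apply: (@anc_total x); rewrite ?anc_iter ?dep_iter; lia.
Qed.

Lemma within_dist_closed S y z : par_closed S -> r \in S ->
  y \in S -> z \in S -> within_dist e y z #|S|.-1.
Proof.
move=> S_cl rS yS zS; pose eS := [rel u v | [&& e u v, u \in S & v \in S]].
have eS_sym : symmetric eS.
  by move=> u v /=; rewrite e_sym; congr (_ && _); rewrite andbC.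
have to_root u : u \in S -> connect eS u r.
  move Ed: (dep u) => d; elim: d u Ed => [|d IH] u Ed uS; first by rewrite (dep_eq0 Ed).
  apply: (@connect_trans _ _ (par u)); last by rewrite IH ?S_cl // dep_par Ed.
  by rewrite connect1 //= par_edge ?Ed // uS S_cl.
have : connect eS y z.
  apply: connect_trans (to_root _ yS) _.
  by rewrite (sym_connect_sym eS_sym) to_root.
case/connectP=> p0 /shortenP[p pp up _] lp.
have pS : {subset y :: p <= S}.
  move=> u; rewrite inE => /predU1P[->//|]; elim: p y yS pp {up lp} => //= v p IH w wS.
  by case/andP=> /and3P[_ _ vS] pp; rewrite inE => /predU1P[->//|]; apply: IH vS pp.
exists p; split=> //; first by apply: sub_path pp => u v /and3P[].
have : size (y :: p) <= #|S|.
  by rewrite -(card_uniqP up); apply/subset_leq_card/subsetP=> u /pS.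
by rewrite /=; lia.
Qed.

Lemma cover_one S M : par_closed S -> r \in S -> 0 < M -> #|S| < M.*2 ->
  exists c, forall y, y \in S -> within_dist e c y M.-1.
Proof.
move=> S_cl rS M_gt0 card_S.
case: (arg_maxnP dep rS) => /= x xS x_max.
case: (ltnP (dep x) M) => [lt_xM|le_Mx].
  exists r => y yS; apply: within_dist_anc (anc_root y) _.
  by have := x_max y yS; rewrite dep_root0; lia.
have [|c [cx dc card_c]] := @anc_at_height S x M.-1 S_cl xS; first by lia.
have cS : c \in S by move/eqP: cx => <-; apply: par_closed_iter.
exists c => y yS; case: (boolP (anc c y)) => [cy|ncy].
  by apply: within_dist_anc cy _; have := x_max y yS; lia.
have card_I := subset_leq_card (subsetIl (desc S c) [set y | anc y x]).
have card_D := card_desc_setD S c.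
have cy : within_dist e (par c) y #|S :\: desc S c|.-1.
  apply: within_dist_closed.
  - exact: par_closedD.
  - by apply: root_in_setD => //; lia.
  - rewrite !inE S_cl // andbT /=; apply/negP => /anc_dep.
    by rewrite dep_par; lia.
  - by rewrite !inE yS ncy.
have cpc : within_dist e c (par c) 1 by apply: (@within_dist_iter 1); lia.
apply: within_dist_leq (within_dist_trans cpc cy).
have : 0 < #|S :\: desc S c|.
  by apply/card_gt0P; exists r; apply: root_in_setD => //; lia.
by lia.
Qed.

(* A short off-path excursion [y -> z], where [z] is the first ancestor of [y]
   on the path from the root to [x], followed by [z -> c] along that path. *)
Lemma within_dist_thin S x c u w g m y : par_closed S ->
  anc c x -> anc u c -> anc w u ->
  #|desc S w :\: [set v | anc v x]| < g ->
  dep c - dep u + g <= m.+1 ->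
  y \in desc S u -> ~~ anc c y -> within_dist e c y m.
Proof.
move=> S_cl cx uc wu thin le_m; rewrite inE => /andP[yS uy] ncy.
have [n le_n Eu] := ancP _ _ uy.
have ex_j : exists j, anc (iter j par y) x.
  by exists n; rewrite -Eu; apply: anc_trans cx.
case: (ex_minnP ex_j) => j zx j_min.
have le_jn : j <= n by apply: j_min; rewrite -Eu; apply: anc_trans cx.
have lt_jg : j < g.
  apply: leq_ltn_trans thin; apply: (@card_iter_le _ j y) => [|i lt_ij].
    exact: leqW (leq_trans le_jn le_n).
  rewrite !inE par_closed_iter //=; apply/andP; split.
    by apply/negP => /j_min; rewrite leqNgt lt_ij.
  have le_in : i <= n := leq_trans (ltnW lt_ij) le_jn.
  apply: (anc_trans wu); apply: (anc_total uy).
    exact/anc_iter/(leq_trans le_in).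
  by rewrite Eu !dep_iter leq_sub2l.
have zy : anc (iter j par y) y by apply/anc_iter/(leq_trans le_jn).
have dz : dep (iter j par y) = dep y - j := dep_iter j y.
have du : dep u = dep y - n by rewrite Eu dep_iter.
move: (iter j par y) => z in zx zy dz *.
have uz : anc u z by apply: (anc_total uy zy); rewrite dz du leq_sub2l.
have lt_zc : dep z < dep c.
  rewrite ltnNge; apply: contra ncy => le_cz.
  exact: anc_trans (anc_total cx zx le_cz) zy.
have cz : within_dist e c z (dep c - dep z).
  apply: within_dist_sym => //; apply: within_dist_anc => //.
  exact: (anc_total zx cx (ltnW lt_zc)).
have zy' : within_dist e z y j.
  by apply: within_dist_anc zy _; rewrite dz subKn // (leq_trans le_jn).
apply: within_dist_leq (within_dist_trans cz zy').
by move: (anc_dep uz) lt_jg le_m; clear; lia.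
Qed.

Lemma remove_step S b B g M : par_closed S -> r \in S ->
  0 < b -> b + g <= B -> B < M -> g.*2 <= b ->
  (forall y, y \in S -> dep y < M) \/
  exists m c u, [/\ m = b \/ m = B, 0 < dep u, m + g <= #|desc S u| &
    forall y, y \in desc S u -> within_dist e c y m.-1].
Proof.
move=> S_cl rS b_gt0 le_bgB lt_BM le_gb.
case: (arg_maxnP dep rS) => /= x xS x_max.
case: (ltnP (dep x) M) => [lt_xM|le_Mx].
  by left=> y yS; apply: leq_ltn_trans (x_max y yS) lt_xM.
right; have [|w [wx dw card_w]] := @anc_at_height S x B.-1 S_cl xS; first by lia.
case: (leqP (B + g) #|desc S w|) => [big_w|small_w].
  exists B, w, w; split=> //; [by right|by lia|].
  move=> y; rewrite inE => /andP[yS wy]; apply: within_dist_anc wy _.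
  by have := x_max y yS; lia.
have [|c [cx dc _]] := @anc_at_height S x b.-1 S_cl xS; first by lia.
have [|u [ux du card_u]] := @anc_at_height S x (b + g).-1 S_cl xS; first by lia.
exists b, c, u; split; [by left|by lia| |].
  by have := subset_leq_card (subsetIl (desc S u) [set y | anc y x]); lia.
move=> y yu; case: (boolP (anc c y)) => [cy|ncy].
  apply: within_dist_anc cy _; move: yu; rewrite inE => /andP[yS _].
  by have := x_max y yS; lia.
apply: (@within_dist_thin S x c u w g) => //.
- by apply: (anc_total ux cx); lia.
- by apply: (anc_total wx ux); lia.
- by have := cardsID [set v | anc v x] (desc S w); lia.
- by lia.
Qed.

Lemma cover_closed n S s M : size s = n -> par_closed S -> r \in S ->
  sorted ltn (rcons s M) -> all (leq 1) (rcons s M) ->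
  #|S| < \sum_(m <- s) m + M.*2 + (n * n.-1) %/ 6 ->
  exists c : nat -> T, forall y, y \in S ->
    exists2 m, m \in rcons s M & within_dist e (c m) y m.-1.
Proof.
elim: n S s => [|n IH] S s sz_s S_cl rS srt pos card_S.
  move/size0nil: sz_s => Es; move: srt pos card_S.
  rewrite {}Es big_nil mul0n div0n addn0 add0n /= andbT => _ M_gt0 card_S.
  have [c cP] := cover_one S_cl rS M_gt0 card_S.
  by exists (fun=> c) => y yS; exists M; [rewrite inE|apply: cP].
have s_pos : all (leq 1) s by move: pos; rewrite all_rcons => /andP[].
have [|b0 [B [b0_s B_s [b0_gt0 le_b0B lt_BM le_gb0]]]] := sorted_gap srt s_pos.
  by rewrite sz_s.
have [small|] := remove_step S_cl rS b0_gt0 le_b0B lt_BM le_gb0.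
  exists (fun=> r) => y yS; exists M; first by rewrite mem_rcons inE eqxx.
  apply: within_dist_anc (anc_root y) _.
  by have := small y yS; rewrite dep_root0; lia.
move=> [b [c [u [b_eq du card_u cov_u]]]].
have b_s : b \in s by case: b_eq => ->.
have srt' : sorted ltn (rcons (rem b s) M).
  apply: (subseq_sorted ltn_trans _ srt).
  by rewrite -!cats1 cat_subseq // rem_subseq.
have pos' : all (leq 1) (rcons (rem b s) M).
  by apply/allP=> m; rewrite mem_rcons inE => m_in; apply: (allP pos);
     rewrite mem_rcons inE; case/orP: m_in => [->//|/mem_rem->]; rewrite orbT.
have [||||c' cov'] := IH (S :\: desc S u) (rem b s) _ _ _ srt' pos'.
- by rewrite size_rem // sz_s.
- exact: par_closedD.
- exact: root_in_setD.
- have := card_desc_setD S u; move: card_S card_u.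
  rewrite (perm_big _ (perm_to_rem b_s)) big_cons sz_s /=.
  by have := mulnS_divn6_leq n; clear; lia.
have s_uniq : uniq (rcons s M) by apply: (sorted_uniq ltn_trans ltnn).
move: (s_uniq); rewrite rcons_uniq => /andP[Ms us].
exists (fun m => if m == b then c else c' m) => y yS.
case: (boolP (anc u y)) => [uy|nuy].
  exists b; first by rewrite mem_rcons inE b_s orbT.
  by rewrite eqxx; apply: cov_u; rewrite inE yS.
have [|m m_in mP] := cov' y; first by rewrite !inE yS (negbTE nuy).
move: m_in; rewrite mem_rcons inE (mem_rem_uniq b us) !inE => m_in.
exists m; first by rewrite mem_rcons inE; case/orP: m_in => [->//|/andP[_ ->]]; rewrite orbT.
case: eqP => // Em; move: m_in; rewrite Em eqxx orbF => /eqP Eb.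
by rewrite -Eb b_s in Ms.
Qed.

End RootedGraph.

Lemma bfs_tree (T : finType) (e : rel T) (r : T) : symmetric e ->
  (forall x, connect e r x) ->
  exists (par : T -> T) (dep : T -> nat),
    [/\ forall x, 0 < dep x -> e x (par x),
        forall x, dep (par x) = (dep x).-1 &
        forall x, dep x = 0 -> x = r].
Proof.
move=> e_sym conn.
pose walk x n := [exists t : n.-tuple T, path e r t && (last r t == x)].
have walkP x n : reflect (exists p, [/\ path e r p, last r p = x & size p = n]) (walk x n).
  apply: (iffP existsP) => [[t /andP[pt /eqP lt]]|[p [pp lp sp]]].
    by exists t; rewrite size_tuple.
  by exists (Tuple (introT eqP sp)); rewrite /= pp lp eqxx.
have ex_walk x : exists n, walk x n.
  by case/connectP: (conn x) => p pp lp; exists (size p); apply/walkP; exists p.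
pose dep x := ex_minn (ex_walk x).
have dep_walk x : walk x (dep x) by rewrite /dep; case: ex_minnP.
have dep_min x n : walk x n -> dep x <= n.
  by move=> wx; rewrite /dep; case: ex_minnP => m _; apply.
have dep0 x : dep x = 0 -> x = r.
  move=> d0; have /walkP[p [_ lp sp]] := dep_walk x.
  by rewrite -lp (size0nil (etrans sp d0)).
have ex_par x : exists y, (dep y == (dep x).-1) && ((0 < dep x) ==> e x y).
  case: (posnP (dep x)) => [d0|d_gt0]; first by exists x; rewrite d0.
  have /walkP[p [pp lp sp]] := dep_walk x.
  case: (lastP p) pp lp sp => [_ _ /= E|q z]; first by rewrite -E in d_gt0.
  rewrite rcons_path last_rcons size_rcons => /andP[pq ez] Ez sq; subst z.
  exists (last r q); rewrite e_sym ez implybT andbT eqn_leq -sq /=.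
  apply/andP; split; first by apply: dep_min; apply/walkP; exists q.
  have /walkP[q' [pq' lq' sq']] := dep_walk (last r q).
  rewrite -ltnS sq -sq'; apply: dep_min; apply/walkP; exists (rcons q' x).
  by rewrite rcons_path last_rcons size_rcons pq' lq' ez.
exists (fun x => xchoose (ex_par x)), dep; split=> // x.
- by move=> d_gt0; have /andP[_ /implyP/(_ d_gt0)] := xchooseP (ex_par x).
- by have /andP[/eqP] := xchooseP (ex_par x).
Qed.

Theorem theorem3 (a : seq nat) (T : finType) (e : rel T) :
  0 < size a ->
  sorted ltn a ->
  all (fun x => 0 < x) a ->
  is_tree e ->
  #|T| <= \sum_(x <- a) x + last 0 a - 1
          + (size a ^ 2 + 2 - 3 * size a) %/ 6 ->
  burnable e a.
Proof.
case/lastP: a => [//|s M] _ srt pos [[e_sym _] /card_gt0P[r _] conn _] card_T.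
have [par [dep [par_edge dep_par dep0]]] := bfs_tree e_sym (conn r).
have M_gt0 : 0 < M by move: pos; rewrite all_rcons => /andP[].
have card_bound : #|[set: T]| < \sum_(m <- s) m + M.*2 + (size s * (size s).-1) %/ 6.
  move: card_T; rewrite cardsT -cats1 big_cat big_seq1 last_cat size_cat /= addn1.
  have -> : (size s).+1 ^ 2 + 2 - 3 * (size s).+1 = size s * (size s).-1.
    by case: (size s) => // n; rewrite -mulnn /=; lia.
  by lia.
have [| |c cP] := cover_closed e_sym par_edge dep_par dep0 erefl _ _ srt pos card_bound.
- by move=> y; rewrite !inE.
- by rewrite inE.
exists (fun i => c (nth 0 (rcons s M) i)) => y.
have [|m m_in my] := cP y; first by rewrite inE.
have lt_m : index m (rcons s M) < size (rcons s M) by rewrite index_mem.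
by exists (Ordinal lt_m); rewrite /= nth_index.
Qed.
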